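(* Let $d,p\in\mathbb N$ be such that $p\ge d\ge1$ and let $\mathbf a=(a_1,\ldots,a_p)\in(\mathbb Z_+)^p$ be a vector of positive integers. Then $h^{\Delta_t(d,p,\mathbf a)}$ is a pure $O$-sequence for all $t=0,\ldots,d-2$.
   Context: For $\mathbf a=(a_1,\ldots,a_p)$ a vector of positive integers, let $n=a_1+\cdots+a_p$ and let $A_1,\ldots,A_p$ be a partition of $[n]=\{1,\ldots,n\}$ with $|A_i|=a_i$. For $t=0,\ldots,d-2$, $\Delta_t(d,p,\mathbf a)$ is the simplicial complex on $[n]$ (a matroid) generated by all sets $\{v_1,\ldots,v_t,v_{i_1},\ldots,v_{i_{d-t}}\}$ with $t<i_1<\cdots<i_{d-t}\le p$ and $v_i\in A_i$ for each index $i$ occurring. $\Bbbk$ is a field, $S=\Bbbk[x_1,\ldots,x_n]$, and for a simplicial complex $\Delta$ on $[n]$ with set of facets $\mathcal F(\Delta)$, $J(\Delta)=\bigcap_{F\in\mathcal F(\Delta)}(x_i : i\in F)$ is the cover ideal. $h^\Delta$ denotes the $h$-vector of $S/J(\Delta)$, i.e. the coefficient vector of the polynomial $h(t)$ with Hilbert series of $S/J(\Delta)$ equal to $h(t)/(1-t)^{\dim S/J(\Delta)}$. An order ideal is a finite set of monomials closed under taking divisors; it is pure if its maximal (with respect to divisibility) monomials all have the same degree. A pure $O$-sequence is the vector counting by degree the monomials of a pure order ideal. *)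

(* Defs.v *)
From mathcomp Require Import all_boot all_order all_algebra.
From mathcomp Require Import finmap.
From mathcomp Require Export mpoly.

Set Implicit Arguments.
Unset Strict Implicit.
Unset Printing Implicit Defensive.

Import GRing.Theory.

Local Open Scope ring_scope.

(* The blocks A_1, ..., A_p are indexed from 0, so "i <= t" becomes i < t. *)
Definition is_block_partition (n p : nat) (a : 'I_p -> nat)
    (A : 'I_p -> {set 'I_n}) : Prop :=
  [/\ forall i, #|A i| = a i,
      forall i j, i != j -> [disjoint A i & A j]
    & \bigcup_i A i = [set: 'I_n]].

(* I is the set of indices {i_1 < ... < i_(d-t)}; the values of v at the
   indices outside of {1, ..., t} and I are irrelevant. *)
Definition is_Delta_generator (n p : nat) (d t : nat) (A : 'I_p -> {set 'I_n})
    (F : {set 'I_n}) : bool :=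
  [exists v : {ffun 'I_p -> 'I_n}, exists I : {set 'I_p},
    [&& [forall i, v i \in A i],
        #|I| == (d - t)%N,
        [forall i in I, t <= i]%N
      & F == v @: ([set i : 'I_p | (i < t)%N] :|: I)]].

Definition Delta (n p : nat) (d t : nat) (A : 'I_p -> {set 'I_n}) :
    {set {set 'I_n}} :=
  [set G : {set 'I_n} |
    [exists F : {set 'I_n}, is_Delta_generator d t A F && (G \subset F)]].

Definition facets (n : nat) (D : {set {set 'I_n}}) : {set {set 'I_n}} :=
  [set F | maxset (mem D) F].

Definition in_var_ideal (k : fieldType) (n : nat) (F : {set 'I_n})
    (f : {mpoly k[n]}) : Prop :=
  exists c : 'I_n -> {mpoly k[n]}, f = \sum_(i in F) c i * 'X_i.

Definition cover_ideal (k : fieldType) (n : nat) (D : {set {set 'I_n}})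
    (f : {mpoly k[n]}) : Prop :=
  forall F, F \in facets D -> in_var_ideal F f.

(* A chain P_0 < ... < P_r of prime ideals of R / I, given as prime ideals of
   R containing I. *)
Definition is_prime_chain (R : comNzRingType) (I : R -> Prop) (r : nat)
    (P : 'I_r.+1 -> prime_idealr R) : Prop :=
  (forall i x, I x -> P i x) /\
  (forall i j : 'I_r.+1, (i < j)%N ->
     (forall x, P i x -> P j x) /\ (exists2 x, P j x & ~~ P i x)).

Definition is_krull_dim_quot (R : comNzRingType) (I : R -> Prop) (D : nat) :
    Prop :=
  (exists P : 'I_D.+1 -> prime_idealr R, is_prime_chain I P) /\
  (forall (r : nat) (P : 'I_r.+1 -> prime_idealr R),
     is_prime_chain I P -> (r <= D)%N).

(* dim_k S_j / (I :&: S_j) = m for S = k[x_1, ..., x_n] and a homogeneous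
   ideal I: the classes of b_1, ..., b_m are a basis of the quotient. *)
Definition is_quot_dim (k : fieldType) (n : nat) (I : {mpoly k[n]} -> Prop)
    (j m : nat) : Prop :=
  exists b : 'I_m -> {mpoly k[n]},
    [/\ forall i, b i \is j.-homog,
        forall f, f \is j.-homog ->
          exists c : 'I_m -> k, I (f - \sum_i c i *: b i)
      & forall c : 'I_m -> k, I (\sum_i c i *: b i) -> forall i, c i = 0].

(* H(0) + H(1) t + ... = h(t) / (1 - t)^D, with denominators cleared and the
   coefficients of t^j compared. *)
Definition is_hilbert_series (H : nat -> nat) (h : {poly int}) (D : nat) :
    Prop :=
  forall j : nat, h`_j = \sum_(i < j.+1) ((1 - 'X) ^+ D)`_i * (H (j - i)%N)%:Z.

Definition is_h_poly (k : fieldType) (n : nat) (I : {mpoly k[n]} -> Prop)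
    (h : {poly int}) : Prop :=
  exists (D : nat) (H : nat -> nat),
    [/\ is_krull_dim_quot I D,
        forall j, is_quot_dim I j (H j)
      & is_hilbert_series H h D].

Definition is_order_ideal (m : nat) (M : {fset 'X_{1..m}}) : Prop :=
  forall u w : 'X_{1..m}, u \in M -> (w <= u)%MM -> w \in M.

Definition is_max_monomial (m : nat) (M : {fset 'X_{1..m}}) (u : 'X_{1..m}) :
    Prop :=
  u \in M /\ forall w, w \in M -> (u <= w)%MM -> w = u.

Definition is_pure (m : nat) (M : {fset 'X_{1..m}}) : Prop :=
  forall u w, is_max_monomial M u -> is_max_monomial M w -> mdeg u = mdeg w.

Definition degree_vector (m : nat) (M : {fset 'X_{1..m}}) : seq nat :=
  mkseq (fun i => count (fun u : 'X_{1..m} => mdeg u == i) M)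
        (\max_(u <- M) (mdeg u).+1).

Definition is_pure_O_sequence (s : seq int) : Prop :=
  exists (m : nat) (M : {fset 'X_{1..m}}),
    [/\ is_order_ideal M, is_pure M & s = map Posz (degree_vector M)].

(* Main.v *)
(* A monomial lies outside the cover ideal exactly when its support misses a
   facet, that is when no block A_i with i < t is contained in the support (is
   "full") and at least d - t of the remaining blocks are not full.  The
   monomials in which a block of size a is full, resp. not full, have
   generating function X^a / (1 - X)^a, resp. (1 - X^a) / (1 - X)^a.  Examining
   the free blocks one at a time gives
     h_e(a :: s) = X^a h_e(s) + (1 + X + ... + X^(a-1)) h_(e-1)(s),
   with e the number of blocks that must not be full, s the sizes of the
   remaining blocks, and h_0 the product of 1 + ... + X^(a_i - 1) over i < t.

   This recursion is realised by the following monomials: the exponents of the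
   first t variables form the box u_i < a_i, and the exponent of each further
   variable, which runs through consecutive intervals of lengths a_t,
   a_(t+1), ..., determines the blocks that are left for the next variable.  Larger
   exponents leave fewer blocks, so this is an order ideal, and every monomial
   divides one of degree n - d.

   The Krull dimension is n - d because a chain of primes of length r above J
   yields, for each N, N^r elements of degree O(N) that are linearly
   independent modulo J, whereas only O(N^(n-d)) monomials of such degree lie
   outside J. *)

Require Import Defs.
From mathcomp Require Import all_boot all_order all_algebra.
From HB Require Import structures.
From mathcomp Require Import finmap.
From mathcomp Require Import zify ring.

Set Implicit Arguments.
Unset Strict Implicit.
Unset Printing Implicit Defensive.

Import GRing.Theory.

(** * The order ideal *)

(* [b]: sizes of the forced blocks, [s]: sizes of the free blocks, [e]: number
   of free blocks that must not be full.  The exponent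
   vector [u] lists first the [e] stacked exponents, then those of the box. *)
Fixpoint in_stack (b : seq nat) (e : nat) (s u : seq nat) {struct s} : bool :=
  match e, s, u with
  | 0, _, _ => all2 ltn u b
  | e'.+1, a :: s', y :: w =>
      if y < a then in_stack b e' s' w else in_stack b e s' (y - a :: w)
  | _, _, _ => false
  end.

(** The two summands mirror the recursion for the h-polynomial: a first exponent below [a] yields
    the factor 1 + ... + X^(a-1), a shift of it by [a] yields X^a. *)
Fixpoint stack (b : seq nat) (e : nat) (s : seq nat) {struct s} :
    seq (seq nat) :=
  match e, s with
  | 0, _ => foldr (fun a L => [seq y :: w | y <- iota 0 a, w <- L]) [:: [::]] b
  | e'.+1, [::] => [::]
  | e'.+1, a :: s' =>
      [seq y :: w | y <- iota 0 a, w <- stack b e' s'] ++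
      [seq head 0 u + a :: behead u | u <- stack b e s']
  end.

Lemma in_stack0 b s u : in_stack b 0 s u = all2 ltn u b.
Proof. by case: s. Qed.

Lemma stack0 b s : stack b 0 s = stack b 0 [::].
Proof. by case: s. Qed.

Lemma mem_cons_allpairs (a y : nat) (w : seq nat) L :
  (y :: w \in [seq y :: w | y <- iota 0 a, w <- L]) = (y < a) && (w \in L).
Proof.
apply/allpairsPdep/andP => [[y' [w' [+ hw [-> ->]]]]|[hy hw]].
  by rewrite mem_iota => /andP[_ hy].
by exists y, w; rewrite mem_iota.
Qed.

Lemma nil_cons_allpairs (a : nat) L :
  ([::] \in [seq y :: w | y <- iota 0 a, w <- L]) = false.
Proof. by apply/negP => /allpairsPdep [y [w []]]. Qed.

Lemma mem_stack b e s u : (u \in stack b e s) = in_stack b e s u.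
Proof.
elim: s e u => [|a s IH] [|e] u.
- elim: b u => [|a b IHb] [|y u] //=; first by rewrite nil_cons_allpairs.
  by rewrite mem_cons_allpairs IHb.
- by [].
- by rewrite stack0 in_stack0; elim: b u {IH} => [|c b IHb] [|y u] //=;
    rewrite ?nil_cons_allpairs // mem_cons_allpairs IHb.
rewrite [stack _ _ _]/= mem_cat; case: u => [|y w].
  by rewrite nil_cons_allpairs /=; apply/negP => /mapP[].
rewrite mem_cons_allpairs IH /=; case: ltnP => [hy|hy] /=.
  apply/orP/idP => [[//|/mapP[u _ [h _]]]|h]; last by left.
  by move: hy; rewrite h; lia.
rewrite -IH; apply/mapP/idP => [[[|y' w'] + []]|h].
(* The empty vector is never stacked when an exponent is still due, so the defaults of [head] and
   [behead] are not reached. *)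
- by rewrite IH; case: (s).
- by move=> + -> -> /=; rewrite addnK.
by exists (y - a :: w) => //=; rewrite subnK.
Qed.

Lemma uniq_cons_allpairs (a : nat) (L : seq (seq nat)) :
  uniq L -> uniq [seq y :: w | y <- iota 0 a, w <- L].
Proof.
move=> uL; apply: allpairs_uniq => //; first exact: iota_uniq.
by move=> [y w] [y' w'] _ _ [-> ->].
Qed.

Lemma uniq_stack b e s : uniq (stack b e s).
Proof.
elim: s e => [|a s IH] [|e] //; last first.
- rewrite /= cat_uniq uniq_cons_allpairs ?IH //=; apply/andP; split.
    apply/hasPn => u /mapP[u' _ ->]; rewrite mem_cons_allpairs; lia.
  rewrite map_inj_in_uniq ?IH // => -[|y w] [|y' w'];
    rewrite !mem_stack; try by case: (s).
  by move=> _ _ [/addIn -> ->].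
all: try clear IH; rewrite ?stack0 /=; elim: b => [|c b IHb] //=;
  exact: uniq_cons_allpairs.
Qed.

Lemma size_in_stack b e s u : in_stack b e s u -> size u = (e + size b)%N.
Proof.
elim: s e u => [|a s IH] [|e] u //; last first.
- by case: u => [|y w] //=; case: ifP => _ /IH /= => [->|].
all: try clear IH; rewrite in_stack0; elim: b u => [|c b IHb] [|y u] //=;
  by move=> /andP[_ /IHb ->].
Qed.

(** An extra block in front either absorbs the first exponent, whose tail then fits the old blocks
    by [tl], or lowers that exponent by [a], which is harmless by [dn]. The induction is on [e]
    because [tl] uses the claim for one exponent fewer. *)
Lemma in_stack_cons b e s a u : in_stack b e s u -> in_stack b e (a :: s) u.
Proof.
elim: e s a u => [|e IHe] s a [|y w]; rewrite ?in_stack0 //; first by case: s.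
have tl s0 y0 : in_stack b e.+1 s0 (y0 :: w) -> in_stack b e s0 w.
  elim: s0 y0 => [|a0 s0 IH] y0 //=; case: ifP => _ h; apply: IHe => //.
  exact: IH h.
have dn s0 y0 y1 : y1 <= y0 ->
    in_stack b e.+1 s0 (y0 :: w) -> in_stack b e.+1 s0 (y1 :: w).
  elim: s0 y0 y1 => [|a0 s0 IH] y0 y1 //= le10; case: ltnP => h0 h.
    by rewrite (leq_ltn_trans le10 h0).
  case: ltnP => h1; first exact: tl h.
  by apply: IH h; lia.
move=> h /=; case: ltnP => hy; first exact: tl h.
by apply: dn h; lia.
Qed.

Lemma in_stack_tail b e s y w : in_stack b e.+1 s (y :: w) -> in_stack b e s w.
Proof.
elim: s y => [|a s IH] y //=; case: ifP => _ h; apply: in_stack_cons => //.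
exact: IH h.
Qed.

(** Closure under divisors. If the smaller first exponent stops in block [a] while the larger one
    passes it, the tail gets all of the remaining blocks, which suffices by [in_stack_tail]. *)
Lemma in_stack_down b e s u w : all2 leq w u -> in_stack b e s u ->
  in_stack b e s w.
Proof.
elim: s e u w => [|a s IH] [|e] u w //; last first.
- case: u w => [|y u] [|z w] //= /andP[le_zy le_wu]; case: ltnP => hy h.
    by rewrite (leq_ltn_trans le_zy hy); apply: IH h.
  case: ltnP => hz; first exact: IH le_wu (in_stack_tail h).
  by apply: IH h => /=; rewrite le_wu andbT; lia.
all: try clear IH; rewrite !in_stack0; elim: b u w => [|c b IHb] [|y u] [|z w] //=;
  by move=> /andP[h1 /IHb IH] /andP[h2 /IH ->]; rewrite andbT; lia.
Qed.

Lemma box_top (b u : seq nat) : all2 ltn u b ->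
  exists2 v, all2 leq u v &
    all2 ltn v b /\ (sumn v + size b = sumn b)%N.
Proof.
elim: b u => [|c b IH] [|y u] //= => [_|/andP[hy /IH[v h1 [h2 h3]]]].
  by exists [::].
exists (c.-1 :: v) => /=; first by rewrite h1 andbT; lia.
by split; [rewrite h2 andbT|]; lia.
Qed.

(** Each stacked exponent can be raised to one less than the end of the block where it stops, and
    the last one can be pushed through all blocks that are left. So the blocks of [s] are exhausted
    with a loss of 1 per stacked exponent, and the box loses 1 per variable. *)
Lemma in_stack_top b e s u : all (ltn 0) s -> in_stack b e.+1 s u ->
  exists2 v, all2 leq u v &
    in_stack b e.+1 s v /\ (sumn v + size b + e.+1 = sumn s + sumn b)%N.
Proof.
elim: s e u => [|a s IH] e [|y w] //= /andP[a_gt0 s_gt0]; case: ltnP => hy h.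
  case: e h => [|e] h; last first.
    have [v h1 [h2 h3]] := IH _ _ s_gt0 h.
    exists (a.-1 :: v); first by rewrite /= h1 andbT; lia.
    by rewrite prednK // leqnn /= h2; split=> //; lia.
  rewrite in_stack0 in h; case: s s_gt0 IH => [|a' s] s_gt0 IH.
    have [v h1 [h2 h3]] := box_top h.
    exists (a.-1 :: v); first by rewrite /= h1 andbT; lia.
    by rewrite prednK // leqnn /= h2; split=> //; lia.
  (* Stopping the last stacked exponent at [a - 1] would waste the blocks [a' :: s]. It passes block
     [a] instead and restarts at 0, which lies inside the next block since [a'] is positive. *)
  have h' : in_stack b 1 (a' :: s) (0 :: w).
    by case/andP: s_gt0 => /= ->; rewrite in_stack0.
  have [[|z v] //= h1 [h2 h3]] := IH 0 (0 :: w) s_gt0 h'.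
  exists (z + a :: v); first by rewrite /= h1 andbT; lia.
  by rewrite ltnNge leq_addl /= addnK; split=> //; lia.
have [[|z v] //= /andP[h0 h1] [h2 h3]] := IH _ _ s_gt0 h.
exists (z + a :: v); first by rewrite /= h1 andbT; lia.
by rewrite ltnNge leq_addl /= addnK; split=> //; lia.
Qed.

Lemma stack_neq0 b e s : all (ltn 0) b -> all (ltn 0) s -> e <= size s ->
  in_stack b e s (nseq (e + size b) 0).
Proof.
move=> b_gt0; elim: s e => [|a s IH] [|e] //=; last first.
  by move=> /andP[-> s_gt0] /= le; apply: IH.
all: by try clear IH; move=> _ _; elim: b b_gt0 => [|c b IHb] //= /andP[-> /IHb ->].
Qed.

Local Open Scope ring_scope.

(** * Generating functions of the monomials outside the cover ideal *)

(* [(1 - X)^n] times the generating function of the monomials for which at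
   least [e] blocks, among blocks of sizes [s], are not full. *)
Fixpoint numer (e : nat) (s : seq nat) {struct s} : {poly int} :=
  match e, s with
  | 0%N, _ => 1
  | _.+1, [::] => 0
  | e'.+1, a :: s' => 'X^a * numer e s' + (1 - 'X^a) * numer e' s'
  end.

Lemma numer0 s : numer 0 s = 1.
Proof. by case: s. Qed.

Lemma geom_sum (a : nat) (x : {poly int}) :
  (1 - x) * (\sum_(y <- iota 0 a) x ^+ y) = 1 - x ^+ a.
Proof.
have -> : iota 0 a = index_iota 0 a by rewrite /index_iota subn0.
elim: a => [|a IH]; first by rewrite big_nil mulr0 subrr.
by rewrite big_nat_recr //= mulrDr IH exprS; ring.
Qed.

Lemma sum_cons_allpairs (a : nat) (L : seq (seq nat)) :
  \sum_(u <- [seq y :: w | y <- iota 0 a, w <- L]) 'X^(sumn u) =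
  (\sum_(y <- iota 0 a) 'X^y) * (\sum_(w <- L) 'X^(sumn w)) :> {poly int}.
Proof.
rewrite big_allpairs_dep /= mulr_suml; apply: eq_bigr => y _.
by rewrite mulr_sumr; apply: eq_bigr => w _; rewrite exprD.
Qed.

(** Both sides obey the recursion of [numer]: one factor 1 - X turns the geometric sum of the first
    exponent into 1 - X^a, and the shift by [a] multiplies by X^a. The box accounts for the product
    over [b]. *)
Lemma stack_numer b e s :
  (1 - 'X) ^+ (e + size b) * (\sum_(u <- stack b e s) 'X^(sumn u)) =
  (\prod_(a <- b) (1 - 'X^a)) * numer e s :> {poly int}.
Proof.
elim: s e => [|a s IH] [|e]; last first.
- rewrite /= big_cat /= sum_cons_allpairs mulrDr.
  rewrite addSn exprS mulrACA geom_sum IH big_map.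
  rewrite (eq_big_seq (fun u => 'X^a * 'X^(sumn u))); last first.
    move=> [|y w]; rewrite mem_stack; first by case: (s).
    by move=> _ /=; rewrite -exprD; congr (_ ^+ _); lia.
  by rewrite -mulr_sumr [X in _ + X]mulrCA -exprS -(addSn e) IH; ring.
- rewrite stack0 numer0 /= mulr1 {IH}.
  elim: b => [|c b IH] /=; first by rewrite big_seq1 big_nil mulr1.
  rewrite sum_cons_allpairs addnS exprS mulrACA geom_sum.
  by rewrite (IH) big_cons.
- by rewrite /= big_nil !mulr0.
rewrite /= mulr1.
elim: b => [|c b IH] /=; first by rewrite big_seq1 big_nil mulr1.
by rewrite sum_cons_allpairs addnS exprS mulrACA geom_sum IH big_cons.
Qed.

(* Congruence modulo ['X^K]: power series in [X] are replaced by the polynomials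
   that count the monomials with all exponents below [K]. *)
Definition eqX (K : nat) (f g : {poly int}) :=
  forall i, (i < K)%N -> f`_i = g`_i.

Lemma eqX_sym K f g : eqX K f g -> eqX K g f.
Proof. by move=> h i /h. Qed.

Lemma eqX_trans K g f h : eqX K f g -> eqX K g h -> eqX K f h.
Proof. by move=> h1 h2 i hi; rewrite h1 ?h2. Qed.

Lemma eqXD K f1 f2 g1 g2 :
  eqX K f1 g1 -> eqX K f2 g2 -> eqX K (f1 + f2) (g1 + g2).
Proof. by move=> h1 h2 i hi; rewrite !coefD h1 ?h2. Qed.

Lemma eqXM K f1 f2 g1 g2 :
  eqX K f1 g1 -> eqX K f2 g2 -> eqX K (f1 * f2) (g1 * g2).
Proof.
move=> h1 h2 i hi; rewrite !coefM; apply: eq_bigr => j _.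
by rewrite h1 ?h2 //; have := ltn_ord j; lia.
Qed.

Lemma eqX_sum K (I : Type) (r : seq I) (P : pred I) (F G : I -> {poly int}) :
  (forall i, P i -> eqX K (F i) (G i)) ->
  eqX K (\sum_(i <- r | P i) F i) (\sum_(i <- r | P i) G i).
Proof.
move=> h; apply: (big_ind2 (fun f g => eqX K f g)) => //.
by move=> ? ? ? ?; apply: eqXD.
Qed.

Lemma eqX_prod K (I : Type) (r : seq I) (P : pred I) (F G : I -> {poly int}) :
  (forall i, P i -> eqX K (F i) (G i)) ->
  eqX K (\prod_(i <- r | P i) F i) (\prod_(i <- r | P i) G i).
Proof.
move=> h; apply: (big_ind2 (fun f g => eqX K f g)) => //.
by move=> ? ? ? ?; apply: eqXM.
Qed.

Lemma geom_eqX K : eqX K ((1 - 'X) * \sum_(j < K) 'X^j) 1.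
Proof.
move=> i hi.
have -> : \sum_(j < K) 'X^j = \sum_(y <- iota 0 K) 'X^y :> {poly int}.
  by rewrite -[iota 0 K](_ : index_iota 0 K = _) ?big_mkord // /index_iota subn0.
by rewrite geom_sum coefB coefXn (ltn_eqF hi) subr0.
Qed.

(** Modulo X^K, the polynomial 1 - X has the inverse 1 + X + ... + X^(K-1). *)
Lemma eqX_lcancel K r f g :
  eqX K ((1 - 'X) ^+ r * f) ((1 - 'X) ^+ r * g) -> eqX K f g.
Proof.
move=> h; have unit_f f' :
    eqX K f' ((\sum_(j < K) 'X^j) ^+ r * ((1 - 'X) ^+ r * f')).
  apply: eqX_sym; rewrite mulrA -exprMn -[X in eqX _ _ X]mul1r.
  apply: eqXM => //; elim: r {h} => [|r IH]; first by rewrite expr0.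
  rewrite exprS -[X in eqX _ _ X]mulr1; apply: eqXM => //.
  by rewrite mulrC; exact: geom_eqX.
apply: eqX_trans (unit_f f) _; apply: eqX_trans (eqX_sym (unit_f g)).
exact: eqXM.
Qed.

(** * Generating functions of monomials with prescribed full blocks *)

Definition full (n K p : nat) (A : 'I_p -> {set 'I_n}) (f : {ffun 'I_n -> 'I_K})
    (i : 'I_p) := [forall v in A i, 0 < f v]%N.

(** Fullness of all blocks in [J] is a condition on each variable separately, which lets the
    generating function factor over the variables. *)
Lemma prod_full n K p (A : 'I_p -> {set 'I_n}) (f : {ffun 'I_n -> 'I_K})
    (J : {set 'I_p}) :
  \prod_(i in J) (full A f i)%:R =
  \prod_v ((v \in \bigcup_(i in J) A i) ==> (0 < f v)%N)%:R :> {poly int}.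
Proof.
have big_bool (I : finType) (P Q : pred I) :
    \prod_(i | P i) (Q i)%:R = [forall (i | P i), Q i]%:R :> {poly int}.
  case: (boolP [forall (i | P i), Q i]) => [/'forall_implyP h|].
    by rewrite big1 // => i /h ->.
  rewrite negb_forall => /existsP[i]; rewrite negb_imply => /andP[Pi nQi].
  by rewrite (bigD1 i) //= (negPf nQi) mul0r.
rewrite !big_bool; congr (nat_of_bool _)%:R; apply/'forall_implyP/forallP => /=.
  move=> h v; apply/implyP => /bigcupP[i iJ vi].
  by have /'forall_implyP := h i iJ; apply.
move=> h i iJ; apply/'forall_implyP => v vi; apply: (implyP (h v)).
by apply/bigcupP; exists i.
Qed.

Lemma card_bigcup_disjoint (T I : finType) (A : I -> {set T}) (J : {set I}) :
  (forall i j, i != j -> [disjoint A i & A j]) ->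
  #|\bigcup_(i in J) A i| = (\sum_(i in J) #|A i|)%N.
Proof.
move=> dA; rewrite big_mkcond [RHS]big_mkcond -sum1_card /=.
rewrite partition_disjoint_bigcup => [|i j /dA dij]; last first.
  by do 2!case: (_ \in J) => //; rewrite ?disjoints_subset ?sub0set ?setC0 ?subsetT.
by apply: eq_bigr => i _; case: (i \in J); rewrite sum1_card ?cards0.
Qed.

(** A variable in a block of [J] contributes X / (1 - X), any other one 1 / (1 - X). By disjointness
    the factors X collect to one power per block. *)
Lemma gf_full n K p (A : 'I_p -> {set 'I_n}) (J : {set 'I_p}) :
  (forall i j, i != j -> [disjoint A i & A j]) ->
  eqX K ((1 - 'X) ^+ n *
         \sum_(f : {ffun 'I_n -> 'I_K})
            'X^(\sum_v f v) * \prod_(i in J) (full A f i)%:R)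
        (\prod_(i in J) 'X^#|A i|).
Proof.
move=> dA; pose U := \bigcup_(i in J) A i.
pose F v (j : 'I_K) : {poly int} := 'X^j * ((v \in U) ==> (0 < j)%N)%:R.
have -> : \sum_(f : {ffun 'I_n -> 'I_K})
            'X^(\sum_v f v) * \prod_(i in J) (full A f i)%:R =
          \prod_v \sum_j F v j.
  rewrite bigA_distr_bigA; apply: eq_bigr => f _; rewrite prod_full.
  by rewrite (big_morph _ (exprD 'X) (expr0 'X)) -big_split.
have -> : (1 - 'X) ^+ n = \prod_(v < n) (1 - 'X) :> {poly int}.
  by rewrite prodr_const card_ord.
have -> : \prod_(i in J) 'X^#|A i| = \prod_(v < n) 'X^(v \in U) :> {poly int}.
  rewrite -!(big_morph _ (exprD 'X) (expr0 'X)); congr (_ ^+ _).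
  rewrite -card_bigcup_disjoint // -sum1_card big_mkcond /=.
  by apply: eq_bigr => v _; case: (v \in _).
rewrite -big_split /=; apply: eqX_prod => v _; rewrite /F; case: (v \in U) => /=.
  apply: (@eqX_trans _ ('X * ((1 - 'X) * \sum_(j < K) 'X^j))).
    rewrite mulrCA; apply: eqXM => //; case: K {F} => [|K]; first by [].
    (* The bound is now [K.+1]. The term j = 0 vanishes on the left, and on the right the top term
       becomes X^(K+1), which is 0 modulo X^(K+1). *)
    rewrite big_ord_recl mulr0 add0r [X in _ * X]big_ord_recr /= mulrDr.
    rewrite mulr_sumr -[X in eqX _ X]addr0; apply: eqXD.
      by apply: eqX_sum => j _; rewrite mulr1 /bump /= add1n exprS.
    by move=> j hj; rewrite -exprS coefXn coef0 ltn_eqF.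
  by rewrite -['X^_](mulr1 'X); apply: eqXM => //; exact: geom_eqX.
under eq_bigr do rewrite mulr1.
exact: geom_eqX.
Qed.

(** Expanding the product over subsets [J] of blocks reduces to [gf_full]. The weights (1, 0), (0,
    1) and (1, -1) encode no condition, full and not full. *)
Lemma gf_linear n K p (A : 'I_p -> {set 'I_n}) (al be : 'I_p -> {poly int}) :
  (forall i j, i != j -> [disjoint A i & A j]) ->
  eqX K ((1 - 'X) ^+ n *
         \sum_(f : {ffun 'I_n -> 'I_K})
            'X^(\sum_v f v) * \prod_i (al i + be i * (full A f i)%:R))
        (\prod_i (al i + be i * 'X^#|A i|)).
Proof.
move=> dA.
have expand (x : 'I_p -> {poly int}) : \prod_i (al i + be i * x i) =
    \sum_(J : {set 'I_p}) ((\prod_(i in ~: J) al i) * \prod_(i in J) be i) *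
       \prod_(i in J) x i.
  under eq_bigr do rewrite addrC.
  rewrite bigA_distr; apply: eq_bigr => J _.
  rewrite (bigID [in J]) /= mulrC -mulrA; congr (_ * _).
    by apply: eq_big => i; [rewrite inE | move/negPf->].
  by rewrite -big_split; apply: eq_bigr => i /= ->.
rewrite expand.
have -> : (1 - 'X) ^+ n * (\sum_(f : {ffun 'I_n -> 'I_K})
       'X^(\sum_v f v) * \prod_i (al i + be i * (full A f i)%:R)) =
    \sum_(J : {set 'I_p}) ((\prod_(i in ~: J) al i) * \prod_(i in J) be i) *
      ((1 - 'X) ^+ n * \sum_(f : {ffun 'I_n -> 'I_K})
            'X^(\sum_v f v) * \prod_(i in J) (full A f i)%:R).
  under eq_bigr do rewrite expand mulr_sumr.
  rewrite exchange_big mulr_sumr; apply: eq_bigr => J _ /=.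
  rewrite mulrCA; congr (_ * _); rewrite mulr_sumr; apply: eq_bigr => f _.
  by rewrite mulrCA.
by apply: eqX_sum => J _; apply: eqXM => //; exact: gf_full.
Qed.

Definition nonfull_ge n K p (A : 'I_p -> {set 'I_n}) (e : nat) (s : seq 'I_p)
    (f : {ffun 'I_n -> 'I_K}) := (e <= count (fun i => ~~ full A f i) s)%N.

(** Induction on [s], splitting by whether its first block is full. The answer is recorded in the
    weights [al], [be] of that block; the blocks still in [s] carry the neutral weight (1, 0). *)
Lemma gf_nonfull n K p (A : 'I_p -> {set 'I_n}) (e : nat) (s : seq 'I_p)
    (al be : 'I_p -> {poly int}) :
  (forall i j, i != j -> [disjoint A i & A j]) ->
  uniq s -> (forall i, i \in s -> al i = 1 /\ be i = 0) ->
  eqX K ((1 - 'X) ^+ n *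
         \sum_(f : {ffun 'I_n -> 'I_K})
            'X^(\sum_v f v) * \prod_i (al i + be i * (full A f i)%:R) *
              (nonfull_ge A e s f)%:R)
        ((\prod_i (al i + be i * 'X^#|A i|)) *
           numer e [seq #|A i| | i <- s]).
Proof.
move=> dA; elim: s e al be => [|i s IH] [|e] al be //; last first.
- move=> /= /andP[nis us] ab.
  pose upd (g : 'I_p -> {poly int}) (c : {poly int}) j := if j == i then c else g j.
  have ab' c c' j : j \in s -> upd al c j = 1 /\ upd be c' j = 0.
    move=> js; rewrite /upd; case: eqP => [ji|_]; first by rewrite -ji js in nis.
    by apply: ab; rewrite inE js orbT.
  have prodE c c' x :
      \prod_j (upd al c j + upd be c' j * x j) =
      (c + c' * x i) * \prod_j (al j + be j * x j).
    rewrite (bigD1 i) //= [in RHS](bigD1 i) //= /upd eqxx.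
    have [-> ->] := ab i (mem_head _ _); rewrite mul0r addr0 mul1r.
    by congr (_ * _); apply: eq_bigr => j /negPf ->.
  have h1 := IH e.+1 _ _ us (ab' 0 1).
  have h2 := IH e _ _ us (ab' 1 (-1)).
  have {h1 h2} := eqXD h1 h2.
  rewrite -mulrDr -big_split /= !prodE => h.
  apply: eqX_trans; last first.
    by apply: eqX_trans h _; rewrite add0r mul1r mulN1r => j _;
      apply: (congr1 (fun q : {poly int} => q`_j)); ring.
  move=> j _; apply: (congr1 (fun q : {poly int} => ((1 - 'X) ^+ n * q)`_j)).
  apply: eq_bigr => f _; rewrite !prodE /nonfull_ge /=.
  case: (full A f i) => /=; rewrite ?add0n ?add1n ?ltnS; ring.
- move=> _ _; rewrite numer0 mulr1;
  under [X in eqX _ (_ * X) _]eq_bigr => f _ do rewrite /nonfull_ge leq0n mulr1.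
  exact: gf_linear.
- by move=> _ _; rewrite mulr0 big1 ?mulr0 // => f _; rewrite mulr0.
move=> _ _; rewrite numer0 mulr1;
under [X in eqX _ (_ * X) _]eq_bigr => f _ do rewrite /nonfull_ge leq0n mulr1.
exact: gf_linear.
Qed.

(** * Monomials outside a cover ideal *)

Definition avoids (n : nat) (D : {set {set 'I_n}}) (m : 'X_{1..n}) : bool :=
  [exists F in facets D, [forall i in F, m i == 0%N]].

Lemma in_var_ideal0 (k : fieldType) (n : nat) (F : {set 'I_n}) :
  in_var_ideal F (0 : {mpoly k[n]}).
Proof. by exists (fun _ => 0); rewrite big1 // => i _; rewrite mul0r. Qed.

Lemma in_var_idealD (k : fieldType) (n : nat) (F : {set 'I_n})
    (f g : {mpoly k[n]}) :
  in_var_ideal F f -> in_var_ideal F g -> in_var_ideal F (f + g).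
Proof.
move=> [c ->] [c' ->]; exists (fun i => c i + c' i); rewrite -big_split.
by apply: eq_bigr => i _; rewrite mulrDl.
Qed.

Lemma in_var_idealMX (k : fieldType) (n : nat) (F : {set 'I_n}) (i : 'I_n)
    (f : {mpoly k[n]}) :
  i \in F -> in_var_ideal F (f * 'X_i).
Proof.
move=> iF; exists (fun j => if j == i then f else 0).
rewrite (bigD1 i) //= eqxx big1 ?addr0 // => j /andP[_ /negPf ->].
by rewrite mul0r.
Qed.

Lemma in_var_idealP (k : fieldType) (n : nat) (F : {set 'I_n})
    (f : {mpoly k[n]}) :
  in_var_ideal F f <->
  forall m : 'X_{1..n}, {in F, forall i, m i = 0%N} -> f@_m = 0.
Proof.
split=> [[c ->] m m0|h].
  rewrite raddf_sum big1 //= => i iF; apply/eqP.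
  apply: contraT; rewrite -mcoeff_msupp (perm_mem (msuppMX _ _)).
  by case/mapP => m' _ mE; have := m0 i iF; rewrite mE mnmDE mnm1E eqxx.
rewrite (mpolyE f) big_seq; apply: big_ind.
- exact: in_var_ideal0.
- exact: in_var_idealD.
move=> m; rewrite mcoeff_msupp => fm.
have [i iF mi] : exists2 i, i \in F & m i != 0%N.
  apply/exists_inP; apply: contraNT fm; rewrite negb_exists_in => /forall_inP m0.
  by apply/eqP/h => i /m0; rewrite negbK => /eqP.
rewrite -(submK (m' := m) (m := U_(i)%MM)) ?lep1mP // mpolyXD scalerAl.
exact: in_var_idealMX.
Qed.

Lemma cover_idealP (k : fieldType) (n : nat) (D : {set {set 'I_n}})
    (f : {mpoly k[n]}) :
  cover_ideal D f <-> forall m, avoids D m -> f@_m = 0.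
Proof.
split=> [h m /exists_inP[F /h /in_var_idealP hF /forall_inP m0]|h F FD].
  by apply: hF => i /m0/eqP.
apply/in_var_idealP => m m0; apply: h; apply/exists_inP; exists F => //.
by apply/forall_inP => i /m0 ->.
Qed.

(** Membership in the cover ideal is tested on the coefficients of the avoiding monomials, so those
    of degree [j] form a basis of the quotient. *)
Lemma quot_dim_size (k : fieldType) (n : nat) (D : {set {set 'I_n}}) (j : nat)
    (L : seq 'X_{1..n}) :
  uniq L -> (forall m, (m \in L) = (mdeg m == j) && avoids D m) ->
  is_quot_dim (cover_ideal (k := k) D) j (size L).
Proof.
move=> uL memL; pose b (i : 'I_(size L)) := tnth (in_tuple L) i.
have bL i : b i \in L by exact: mem_tnth.
have b_inj : injective b by apply/tuple_uniqP.
have bP i : (mdeg (b i) == j) && avoids D (b i) by rewrite -memL.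
have coef_b (c : 'I_(size L) -> k) i : (\sum_i c i *: 'X_[b i])@_(b i) = c i.
  rewrite raddf_sum (bigD1 i) //= mcoeffZ mcoeffX eqxx mulr1 big1 ?addr0 // => i' ni.
  by rewrite mcoeffZ mcoeffX (inj_eq b_inj) (negPf ni) mulr0.
exists (fun i => 'X_[b i]); split.
- by move=> i; rewrite dhomogX; case/andP: (bP i).
- move=> f fj; exists (fun i => f@_(b i)); apply/cover_idealP => m Dm.
  rewrite mcoeffB; case: (boolP (m \in L)) => [/(tnthP (in_tuple L))[i ->]|nL].
    by rewrite -/(b i) coef_b subrr.
  rewrite (dhomog_nemf_coeff fj) ?sub0r; last by move: nL; rewrite memL Dm andbT.
  rewrite raddf_sum big1 ?oppr0 //= => i _; rewrite mcoeffZ mcoeffX.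
  by case: eqP => [bm|_]; [rewrite -bm bL in nL | rewrite mulr0].
move=> c /cover_idealP h i; rewrite -(coef_b c i); apply: h.
by case/andP: (bP i).
Qed.

(** * The Hilbert function as a count of bounded exponent functions *)

Definition mnm_ffun (n K : nat) (f : {ffun 'I_n -> 'I_K}) : 'X_{1..n} :=
  [multinom f i : nat | i < n].

Lemma mnm_ffunE n K (f : {ffun 'I_n -> 'I_K}) i : mnm_ffun f i = f i.
Proof. by rewrite /mnm_ffun mnmE. Qed.

Lemma mnm_ffun_inj n K : injective (@mnm_ffun n K).
Proof.
move=> f g /mnmP fg; apply/ffunP => i; apply: val_inj.
by have := fg i; rewrite !mnm_ffunE.
Qed.

Lemma mnm_ffun_surj n K (m : 'X_{1..n}) : (mdeg m < K)%N ->
  exists f : {ffun 'I_n -> 'I_K}, m = mnm_ffun f.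
Proof.
case: K => // K hm.
exists [ffun i => inord (m i)]; apply/mnmP => i; rewrite mnm_ffunE ffunE inordK //.
by apply: leq_ltn_trans hm; rewrite mdegE (bigD1 i) //= leq_addr.
Qed.

(** The bound [K] makes the enumeration finite; as soon as [j < K] it excludes no monomial of degree
    [j]. *)
Definition avoiding (n : nat) (D : {set {set 'I_n}}) (K j : nat) :
    seq 'X_{1..n} :=
  [seq mnm_ffun f | f : {ffun 'I_n -> 'I_K} <- enum predT &
    ((\sum_i f i)%N == j) && avoids D (mnm_ffun f)].

Lemma uniq_avoiding n (D : {set {set 'I_n}}) K j : uniq (avoiding D K j).
Proof.
by rewrite map_inj_uniq 1?filter_uniq ?enum_uniq // => f g; apply: mnm_ffun_inj.
Qed.

Lemma mem_avoiding n (D : {set {set 'I_n}}) K j m : (j < K)%N ->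
  (m \in avoiding D K j) = (mdeg m == j) && avoids D m.
Proof.
move=> jK; apply/mapP/andP => [[f + ->]|[/eqP mj Dm]].
  rewrite mem_filter => /andP[/andP[/eqP fj ->] _]; split=> //.
  by rewrite mdegE -fj; apply/eqP/eq_bigr => i _; rewrite mnm_ffunE.
have [|f mf] := @mnm_ffun_surj n K m; first by rewrite mj.
exists f => //; rewrite mem_filter mem_enum andbT -mf Dm andbT -mj mdegE mf.
by apply/eqP/eq_bigr => i _; rewrite mnm_ffunE.
Qed.

Definition hilb (n : nat) (D : {set {set 'I_n}}) (j : nat) :=
  size (avoiding D j.+1 j).

Lemma hilbE n (D : {set {set 'I_n}}) K j : (j < K)%N ->
  size (avoiding D K j) = hilb D j.
Proof.
move=> jK; apply: perm_size; apply: uniq_perm; rewrite ?uniq_avoiding // => m.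
by rewrite !mem_avoiding.
Qed.

Lemma is_quot_dim_hilb (k : fieldType) n (D : {set {set 'I_n}}) j :
  is_quot_dim (cover_ideal (k := k) D) j (hilb D j).
Proof.
apply: quot_dim_size; first exact: uniq_avoiding.
by move=> m; rewrite mem_avoiding.
Qed.

Lemma coef_hilb n (D : {set {set 'I_n}}) K j : (j < K)%N ->
  (\sum_(f : {ffun 'I_n -> 'I_K})
     'X^(\sum_v f v) * (avoids D (mnm_ffun f))%:R : {poly int})`_j
  = (hilb D j)%:Z.
Proof.
move=> jK; rewrite -(hilbE D jK) /avoiding size_map size_filter coef_sum -sum1_count.
rewrite -natz natr_sum big_enum_cond [RHS]big_mkcond /=; apply: eq_bigr => f _.
rewrite mulr_natr coefMn coefXn eq_sym.
by case: eqP; case: avoids.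
Qed.

Lemma is_hilbert_series_hilb n (D : {set {set 'I_n}}) (h : {poly int})
    (dim : nat) :
  (forall K, eqX K ((1 - 'X) ^+ dim * \sum_(f : {ffun 'I_n -> 'I_K})
     'X^(\sum_v f v) * (avoids D (mnm_ffun f))%:R) h) ->
  is_hilbert_series (hilb D) h dim.
Proof.
move=> hK j; rewrite -(hK j.+1) // coefM; apply: eq_bigr => i _.
by rewrite coef_hilb //; lia.
Qed.

(** * The complex Delta *)

Lemma card_generator n p d t (A : 'I_p -> {set 'I_n}) (F : {set 'I_n}) :
  (t <= d)%N -> (t <= p)%N -> (forall i j, i != j -> [disjoint A i & A j]) ->
  is_Delta_generator d t A F -> #|F| = d.
Proof.
move=> td tp dA /existsP[v /existsP[I]].
move=> /and4P[/forallP vA /eqP cI /forall_inP It /eqP ->].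
rewrite card_imset => [|i j vij]; last first.
  apply: contraTeq (vA i) => /dA /disjointFl; rewrite vij => ->//.
rewrite cardsU disjoint_setI0 ?cards0 ?subn0.
  rewrite cI -sum1dep_card (big_ord_narrow tp) sum1_card card_ord; lia.
rewrite disjoints_subset; apply/subsetP => i; rewrite !inE => it.
by apply/negP => /It; lia.
Qed.

Lemma exists_subset (T : finType) (B : {set T}) (c : nat) : (c <= #|B|)%N ->
  exists2 C : {set T}, C \subset B & #|C| = c.
Proof.
move=> cB; exists [set x in take c (enum B)].
  by apply/subsetP => x; rewrite inE => /mem_take; rewrite mem_enum.
rewrite cardsE (card_uniqP _) ?take_uniq ?enum_uniq // size_takel //.
by rewrite -cardE.
Qed.

(** All generators have [d] elements, so none is properly contained in another. *)
Lemma facets_Delta n p d t (A : 'I_p -> {set 'I_n}) (F : {set 'I_n}) :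
  (t <= d)%N -> (t <= p)%N -> (forall i j, i != j -> [disjoint A i & A j]) ->
  (F \in facets (Delta d t A)) = is_Delta_generator d t A F.
Proof.
move=> td tp dA; rewrite inE; apply/maxsetP/idP => /= [[]|gF].
  rewrite inE => /existsP[G /andP[gG FG]] /(_ G) <- //.
  by rewrite inE; apply/existsP; exists G; rewrite gG subxx.
split=> [|G]; first by rewrite inE; apply/existsP; exists F; rewrite gF subxx.
rewrite inE => /existsP[H /andP[gH GH]] FG; apply/eqP.
rewrite eq_sym eqEcard FG /= (card_generator td tp dA gF).
by rewrite -(card_generator td tp dA gH) subset_leq_card.
Qed.

Definition free_blocks (p t : nat) : seq 'I_p :=
  [seq i : 'I_p <- enum 'I_p | t <= i]%N.

Lemma avoids_Delta n p d t K (A : 'I_p -> {set 'I_n})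
    (f : {ffun 'I_n -> 'I_K}) :
  (t <= d)%N -> (t <= p)%N -> (forall i j, i != j -> [disjoint A i & A j]) ->
  (forall i, 0 < #|A i|)%N ->
  avoids (Delta d t A) (mnm_ffun f) =
  [forall (i : 'I_p | (i < t)%N), ~~ full A f i] &&
  nonfull_ge A (d - t) (free_blocks p t) f.
Proof.
move=> td tp dA A_gt0; pose B := [set i : 'I_p | (t <= i)%N && ~~ full A f i].
have -> : nonfull_ge A (d - t) (free_blocks p t) f = (d - t <= #|B|)%N.
  rewrite /nonfull_ge /free_blocks -sum1_count big_filter_cond big_enum_cond.
  by rewrite /= sum1dep_card.
have nonfullP i : reflect (exists2 v, v \in A i & f v == 0%N :> nat) (~~ full A f i).
  rewrite negb_forall_in; apply: (iffP exists_inP) => -[v vA fv]; exists v => //.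
    by rewrite -leqNgt leqn0 in fv.
  by rewrite (eqP fv).
apply/exists_inP/andP => [[F + /forall_inP F0]|[/forall_inP nf dB]].
  rewrite facets_Delta // => /existsP[v /existsP[I /and4P[/forallP vA /eqP cI]]].
  move=> /forall_inP It /eqP FE.
  have nfF (i : 'I_p) : (i < t)%N || (i \in I) -> ~~ full A f i.
    move=> h; apply/nonfullP; exists (v i) => //.
    by rewrite -mnm_ffunE F0 // FE imset_f // !inE.
  split; first by apply/forall_inP => i it; rewrite nfF ?it.
  rewrite -cI; apply: subset_leq_card; apply/subsetP => i iI.
  by rewrite inE It //= nfF ?iI ?orbT.
have [I IB cI] := exists_subset dB.
(* In a block that is not full, a vertex with exponent 0 is chosen; in a full block any vertex
   serves, since a generator needs [v i] in [A i] for all [i]. *)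
have pickA i : {v | (v \in A i) && (~~ full A f i ==> (f v == 0%N :> nat))}.
  apply: sigW; case: (boolP (full A f i)) => [_|/nonfullP[v vA fv]].
    by have /card_gt0P[v vA] := A_gt0 i; exists v; rewrite vA.
  by exists v; rewrite vA.
pose v := [ffun i => sval (pickA i)].
have vP i : (v i \in A i) && (~~ full A f i ==> (f (v i) == 0%N :> nat)).
  by rewrite ffunE; exact: svalP (pickA i).
exists (v @: ([set i : 'I_p | (i < t)%N] :|: I)).
  rewrite facets_Delta //; apply/existsP; exists v; apply/existsP; exists I.
  rewrite eqxx cI eqxx andbT /=; apply/andP; split.
    by apply/forallP => i; case/andP: (vP i).
  by apply/forall_inP => i /(subsetP IB); rewrite inE => /andP[].
apply/forall_inP => _ /imsetP[i + ->]; rewrite !inE mnm_ffunE => hi.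
have /andP[_ /implyP] := vP i; apply.
by case/orP: hi => [/nf//|/(subsetP IB)]; rewrite inE => /andP[].
Qed.

Lemma gf_Delta n p d t K (A : 'I_p -> {set 'I_n}) :
  (t <= d)%N -> (t <= p)%N -> (forall i j, i != j -> [disjoint A i & A j]) ->
  (forall i, 0 < #|A i|)%N ->
  eqX K ((1 - 'X) ^+ n * \sum_(f : {ffun 'I_n -> 'I_K})
            'X^(\sum_v f v) * (avoids (Delta d t A) (mnm_ffun f))%:R)
        ((\prod_(i < p | (i < t)%N) (1 - 'X^#|A i|)) *
          numer (d - t) [seq #|A i| | i <- free_blocks p t]).
Proof.
move=> td tp dA A_gt0.
(* A forced block gets the weight 1 - [full], a free one the neutral weight 1. *)
pose be (i : 'I_p) : {poly int} := if (i < t)%N then -1 else 0.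
have h := @gf_nonfull n K p A (d - t) (free_blocks p t) (fun=> 1) be dA.
have be1 (x : {poly int}) i : 1 + be i * x = if (i < t)%N then 1 - x else 1.
  by rewrite /be; case: ifP; rewrite ?mul0r ?addr0 ?mulN1r.
have eq_prod (x : 'I_p -> {poly int}) :
    \prod_i (1 + be i * x i) = \prod_(i < p | (i < t)%N) (1 - x i).
  by rewrite [RHS]big_mkcond; apply: eq_bigr => i _; rewrite be1.
rewrite eq_prod in h; apply: eqX_trans; last apply: h.
- move=> i _; apply: (congr1 (fun q : {poly int} => ((1 - 'X) ^+ n * q)`_i)).
  apply: eq_bigr => f _; rewrite avoids_Delta // eq_prod -mulrA; congr (_ * _).
  case: (boolP [forall (i | _), _]) => [/forall_inP nf|] /=.
    by rewrite big1 ?mul1r // => j /nf /negPf ->; rewrite subr0.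
  rewrite negb_forall_in => /exists_inP[j jt]; rewrite negbK => ff.
  by rewrite (bigD1 j) //= ff subrr !mul0r.
- by rewrite filter_uniq // enum_uniq.
by move=> i; rewrite mem_filter => /andP[it _]; rewrite /be ltnNge it.
Qed.

(** * Krull dimension *)

(** Setting the variables of [U] to 0 is a ring endomorphism of a domain, so its kernel, the ideal
    generated by these variables, is prime. *)
Definition kill (k : fieldType) (n : nat) (U : {set 'I_n}) :
    {mpoly k[n]} -> {mpoly k[n]} :=
  comp_mpoly [tuple if i \in U then 0 else 'X_i | i < n].

HB.instance Definition _ (k : fieldType) (n : nat) (U : {set 'I_n}) :=
  GRing.RMorphism.on (@kill k n U).

Lemma killX (k : fieldType) (n : nat) (U : {set 'I_n}) (m : 'X_{1..n}) :
  kill U ('X_[m] : {mpoly k[n]}) =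
  if [forall i in U, m i == 0%N] then 'X_[m] else 0.
Proof.
rewrite /kill comp_mpolyX; case: ifP => [/forall_inP m0|/negbT].
  rewrite [RHS]mpolyXE_id; apply: eq_bigr => i _; rewrite tnth_mktuple.
  by case: ifP => // /m0 /eqP ->; rewrite !expr0.
rewrite negb_forall_in => /exists_inP[i iU mi].
by rewrite (bigD1 i) //= tnth_mktuple iU expr0n (negPf mi) mul0r.
Qed.

Definition var_ideal (k : fieldType) (n : nat) (U : {set 'I_n}) :
  {pred {mpoly k[n]}} := [pred f | kill U f == 0].

Lemma var_ideal_idealr_closed (k : fieldType) (n : nat) (U : {set 'I_n}) :
  idealr_closed (var_ideal (k := k) U).
Proof.
split=> [||f u v]; rewrite !inE ?rmorph0 ?rmorph1 ?oner_eq0 //.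
by move=> /eqP u0 /eqP v0; rewrite rmorphD rmorphM /= u0 v0 mulr0 addr0.
Qed.

Lemma var_ideal_prime (k : fieldType) (n : nat) (U : {set 'I_n}) :
  prime_idealr_closed (var_ideal (k := k) U).
Proof. by move=> u v; rewrite !inE rmorphM mulf_eq0. Qed.

HB.instance Definition _ (k : fieldType) (n : nat) (U : {set 'I_n}) :=
  isIdealr.Build _ (@var_ideal k n U) (@var_ideal_idealr_closed k n U).
HB.instance Definition _ (k : fieldType) (n : nat) (U : {set 'I_n}) :=
  isPrimeIdealrClosed.Build _ (@var_ideal k n U) (@var_ideal_prime k n U).

Lemma var_idealP (k : fieldType) (n : nat) (U : {set 'I_n}) (f : {mpoly k[n]}) :
  var_ideal U f <-> in_var_ideal U f.
Proof.
split=> [/eqP f0|[c ->]].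
  apply/in_var_idealP => m m0.
  have <- : (kill U f)@_m = f@_m; last by rewrite f0 mcoeff0.
  rewrite [in LHS](mpolyE f) [in RHS](mpolyE f) rmorph_sum !raddf_sum.
  apply: eq_bigr => m' _ /=; rewrite [kill U _]comp_mpolyZ -/(kill U _) killX.
  case: ifP => //= /negbT; rewrite negb_forall_in => /exists_inP[i iU m'i].
  rewrite scaler0 mcoeff0 mcoeffZ mcoeffX; case: eqP => [mm|]; last by rewrite mulr0.
  by rewrite mm m0 in m'i.
rewrite /var_ideal /= rmorph_sum big1 //= => i iU; rewrite rmorphM /= killX.
case: ifP => [/forall_inP/(_ i iU)|]; rewrite ?mulr0 // mnm1E eqxx //.
Qed.

Lemma var_ideal_sub (k : fieldType) (n : nat) (U V : {set 'I_n})
    (f : {mpoly k[n]}) :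
  U \subset V -> var_ideal U f -> var_ideal V f.
Proof.
move=> UV /var_idealP/in_var_idealP h; apply/var_idealP/in_var_idealP => m m0.
by apply: h => i /(subsetP UV); exact: m0.
Qed.

Lemma var_idealX (k : fieldType) (n : nat) (U : {set 'I_n}) (i : 'I_n) :
  var_ideal U ('X_i : {mpoly k[n]}) = (i \in U).
Proof.
rewrite /var_ideal /= killX; case: (boolP (i \in U)) => iU.
  by case: ifP => [/forall_inP/(_ i iU)|]; rewrite ?eqxx // mnm1E eqxx.
case: ifP => [_|/negP[]]; first by rewrite -msize_poly_eq0 msizeX.
apply/forall_inP => j jU; rewrite mnm1E.
by case: (i =P j) => // ij; rewrite ij jU in iU.
Qed.

(** The variables outside [F] are added one at a time to the prime ideal of [F]. *)
Lemma var_ideal_chain (k : fieldType) (n : nat) (I : {mpoly k[n]} -> Prop)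
    (F : {set 'I_n}) :
  (forall f, I f -> in_var_ideal F f) ->
  exists P : 'I_(#|~: F|).+1 -> prime_idealr {mpoly k[n]}, is_prime_chain I P.
Proof.
move=> IF; pose e := enum (~: F); pose U i := F :|: [set v in take i e].
have U_sub i j : (i <= j)%N -> U i \subset U j.
  move=> ij; apply: setUS; apply/subsetP => v; rewrite !inE.
  by rewrite -(take_takel e ij); exact: mem_take.
exists (fun i => var_ideal (U i) : prime_idealr _); split=> [i f /IF|i j ij].
  by move=> /var_idealP; apply: var_ideal_sub; exact: subsetUl.
split=> [f|]; first by apply: var_ideal_sub; apply: U_sub; exact: ltnW.
have ie : (i < size e)%N by rewrite -cardE; have := ltn_ord j; lia.
pose v0 := tnth (in_tuple e) (Ordinal ie).
have vF : nth v0 e i \in ~: F by rewrite -mem_enum mem_nth.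
exists 'X_(nth v0 e i); rewrite /= var_idealX !inE.
  apply/orP; right; rewrite -(nth_take _ ij); apply: mem_nth.
  by rewrite size_takel // -cardE -ltnS.
rewrite inE in vF; rewrite (negPf vF) /=; apply/negP => /(nthP v0) [l].
rewrite size_takel ?(ltnW ie) // => li; rewrite nth_take // => /eqP.
by rewrite nth_uniq ?enum_uniq ?(ltn_trans li) // (ltn_eqF li).
Qed.

(** * Upper bound on the length of chains of primes *)

Definition indep_mod (k : fieldType) (R : lmodType k) (P : pred R)
    (T : finType) (b : T -> R) :=
  forall c : T -> k, P (\sum_t c t *: b t) -> forall t, c t = 0.

(* In a relation [sum_i x^i y_i] in [P] with the [y_i] in the span of [b],
   reduction modulo [Q] kills [y_0]; as [x] is not in the prime [P], it can be
   divided out. *)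
Lemma indep_mod_powers (k : fieldType) (n : nat)
    (P Q : prime_idealr {mpoly k[n]})
    (x : {mpoly k[n]}) (T : finType) (b : T -> {mpoly k[n]}) (N : nat) :
  (forall f, P f -> Q f) -> Q x -> ~~ P x -> indep_mod Q b ->
  indep_mod P (fun s : 'I_N * T => x ^+ s.1 * b s.2).
Proof.
move=> PQ Qx Px indQ c.
have -> : \sum_s c s *: (x ^+ s.1 * b s.2) =
    \sum_(i < N) \sum_t c (i, t) *: (x ^+ i * b t).
  by rewrite pair_bigA; apply: eq_bigr => -[].
have idM (J : prime_idealr {mpoly k[n]}) f g : J f -> J (g * f) by apply: idealMr.
have idP (J : prime_idealr {mpoly k[n]}) f g : J (f * g) -> J f \/ J g.
  by move=> h; apply/orP; rewrite -prime_idealrM.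
elim: N c => [|N IH] c; first by move=> _ [[]].
have -> : \sum_(i < N.+1) \sum_t c (i, t) *: (x ^+ i * b t) =
    \sum_t c (ord0, t) *: b t +
    x * \sum_(i < N) \sum_t c (lift ord0 i, t) *: (x ^+ i * b t).
  rewrite big_ord_recl; congr (_ + _).
    by apply: eq_bigr => t _; rewrite expr0 mul1r.
  rewrite mulr_sumr; apply: eq_bigr => i _; rewrite mulr_sumr.
  by apply: eq_bigr => t _; rewrite -scalerAr mulrA -exprS.
set s0 := \sum_t _; set s1 := \sum_(i < N) _ => Ps.
have Qs0 : Q s0.
  rewrite -[s0](addrK (x * s1)); apply: (rpredB (PQ _ Ps) _).
  by rewrite mulrC; apply: idM.
have c0 := indQ _ Qs0.
have {Ps} : P (x * s1).
  by move: Ps; rewrite /s0 big1 ?add0r // => t _; rewrite c0 scale0r.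
case/idP => [h|/(IH (fun s => c (lift ord0 s.1, s.2)))]; first by rewrite h in Px.
move=> c1 [i t]; case: (unliftP ord0 i) => [j ->|->]; last exact: c0.
exact: c1 (j, t).
Qed.

(** Start with 1 modulo the top prime. Each step down the chain multiplies the family by the powers
    x^i with i < N of an element [x] gained at that step. The constant [e] depends on the chain
    alone, so degrees grow linearly in [N]. *)
Lemma chain_indep (k : fieldType) (n : nat) (r : nat)
    (P : nat -> prime_idealr {mpoly k[n]}) :
  (forall i, (i < r)%N ->
     (forall f, P i f -> P i.+1 f) /\ (exists2 x, P i.+1 x & ~~ P i x)) ->
  exists e, forall N, exists (T : finType) (b : T -> {mpoly k[n]}),
    [/\ #|T| = (N ^ r)%N, indep_mod (P 0%N) b
      & forall t, (msize (b t) <= (N * e).+1)%N].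
Proof.
elim: r P => [|r IH] P hP.
  exists 0%N => N; exists unit, (fun=> 1); rewrite card_unit; split=> // [c|t].
    rewrite (big_pred1 tt) => [|[]//] P0 []; apply/eqP.
    apply: contraT => c0; rewrite -(idealr1 (P 0%N)).
    rewrite (_ : 1 = ((c tt)^-1)%:MP * (c tt *: 1)); first exact: idealMr.
    by rewrite mul_mpolyC scalerA mulVf // scale1r.
  by rewrite msize1.
have [|e he] := IH (fun i => P i.+1); first by move=> i ir; exact: hP.
have [//|P01 [x P1x P0x]] := hP 0%N.
(* The summand 3 pays for the additive constants in the size bound of a product; since [i < N], one
   whole copy of [msize x + 3] is left to absorb them. *)
exists (msize x + 3 + e)%N => N; have [T [b [cT ib sb]]] := he N.
exists ('I_N * T)%type, (fun s : 'I_N * T => x ^+ s.1 * b s.2); split.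
- by rewrite card_prod card_ord cT expnS.
- exact: indep_mod_powers ib.
move=> [i t] /=.
have sx j : (msize (x ^+ j) <= (j * (msize x + 3)).+1)%N.
  elim: j => [|j IHj]; first by rewrite expr0 msize1.
  by rewrite exprS; apply: leq_trans (msizeM_le _ _) _; rewrite mulSn; lia.
apply: leq_trans (msizeM_le _ _) _.
have h1 := sx i; have h2 := sb t.
have h3 : (i.+1 * (msize x + 3) <= N * (msize x + 3))%N.
  by rewrite leq_mul2r ltn_ord orbT.
rewrite mulSn in h3; rewrite mulnDr; lia.
Qed.

(** With more elements than avoiding monomials, the matrix of coefficients at these monomials has a
    nonzero left kernel vector, that is, a nontrivial combination lying in the cover ideal. *)
Lemma card_indep (k : fieldType) (n : nat) (D : {set {set 'I_n}})
    (P : pred {mpoly k[n]}) (T : finType) (b : T -> {mpoly k[n]}) (K : nat) :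
  (forall f, cover_ideal D f -> P f) -> indep_mod P b ->
  (forall t, (msize (b t) <= K)%N) ->
  (#|T| <= #|[set f : {ffun 'I_n -> 'I_K} | avoids D (mnm_ffun f)]|)%N.
Proof.
move=> DP ib sb; set M := [set f | _]; rewrite leqNgt; apply/negP => lt.
pose B : 'M[k]_(#|T|, #|M|) :=
  \matrix_(i, j) (b (enum_val i))@_(mnm_ffun (enum_val j)).
have : kermx B != 0.
  rewrite kermx_eq0 /row_free neq_ltn; apply/orP; left.
  exact: leq_ltn_trans (rank_leq_col _) lt.
case/rowV0Pn => u /sub_kermxP uB; case/negP.
apply/eqP/rowP => i; rewrite mxE -[i]enum_valK.
apply: (ib (fun t => u 0 (enum_rank t))); apply: DP; apply/cover_idealP => m Dm.
case: (ltnP (mdeg m) K) => mK; last first.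
  rewrite raddf_sum big1 // => t _ /=; rewrite mcoeffZ.
  by rewrite memN_msupp_eq0 ?mulr0 // msize_mdeg_ge // (leq_trans (sb t)).
have [f mf] := mnm_ffun_surj mK.
have fM : f \in M by rewrite inE -mf.
have /rowP/(_ (enum_rank_in fM f)) := uB; rewrite !mxE => <-.
rewrite raddf_sum (reindex enum_rank) /=; last first.
  by apply: onW_bij; exists enum_val; [exact: enum_rankK | exact: enum_valK].
by apply: eq_bigr => t _; rewrite !mxE mcoeffZ enum_rankK enum_rankK_in // -mf.
Qed.

(** For each facet, an exponent function vanishing on it is free only at the other [n - d]
    variables. *)
Lemma card_avoids (n d K : nat) (D : {set {set 'I_n}}) :
  (forall F, F \in facets D -> #|F| = d) ->
  (#|[set f : {ffun 'I_n -> 'I_K.+1} | avoids D (mnm_ffun f)]| <=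
   #|facets D| * K.+1 ^ (n - d))%N.
Proof.
move=> cD.
pose S F := [set f : {ffun 'I_n -> 'I_K.+1} | f \in pffun_on ord0 (~: F) predT].
apply: (@leq_trans #|\bigcup_(F in facets D) S F|).
  apply: subset_leq_card; apply/subsetP => f; rewrite inE.
  move=> /exists_inP[F FD /forall_inP f0].
  apply/bigcupP; exists F => //; rewrite inE; apply/pffun_onP; split=> //.
  apply/subsetP => i; rewrite !inE; apply: contraNN => /f0; rewrite mnm_ffunE.
  by move=> /eqP fi; apply/eqP/val_inj.
apply: (@leq_trans (\sum_(F in facets D) #|S F|)).
  elim/big_rec2: _ => [|F c B _ le]; first by rewrite cards0.
  by apply: leq_trans (leq_card_setU _ _) _; rewrite leq_add2l.
rewrite -sum_nat_const; apply: leq_sum => F /cD cF.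
rewrite cardsE card_pffun_on cardT size_enum_ord cardsCs setCK cF card_ord.
exact: leqnn.
Qed.

Lemma krull_dim_cover_ideal (k : fieldType) (n d : nat) (D : {set {set 'I_n}}) :
  (forall F, F \in facets D -> #|F| = d) -> (exists F, F \in facets D) ->
  is_krull_dim_quot (cover_ideal (k := k) D) (n - d).
Proof.
move=> cD [F FD]; split.
  have -> : (n - d = #|~: F|)%N by rewrite cardsCs setCK card_ord (cD F FD).
  by apply: var_ideal_chain => f /(_ F FD).
move=> r P [DP chainP]; rewrite leqNgt; apply/negP => lt_r.
have [|e he] := @chain_indep k n r (fun i => P (inord i)).
  move=> i ir; have [|h1 h2] := chainP (inord i) (inord i.+1).
    by rewrite !inordK // ltnW.
  by [].
(* With N = C + 1, the bound #|facets D| (N e + 1)^(n-d) is at most C N^(n-d), hence less than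
   N^(n-d+1), while a chain of length r > n - d gives N^r independent elements. *)
pose C := (#|facets D| * e.+1 ^ (n - d))%N.
have [T [b [cT ib sb]]] := he C.+1.
have := card_indep (DP (inord 0)) ib sb.
move=> /leq_trans/(_ (card_avoids _ cD)); rewrite cT.
apply/negP; rewrite -ltnNge.
apply: (@leq_ltn_trans (C * C.+1 ^ (n - d))).
  rewrite /C -mulnA -expnMn leq_mul2l; apply/orP; right.
  by case: (n - d)%N => // q; rewrite leq_exp2r //; lia.
apply: (@leq_trans (C.+1 ^ (n - d).+1)); last by rewrite leq_pexp2l.
by rewrite expnS ltn_mul2r expn_gt0 ltnSn.
Qed.

(** * Purity *)

Definition mnm_seq (N : nat) (u : seq nat) : 'X_{1..N} :=
  [multinom nth 0%N u i | i < N].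

Lemma mnm_seqK N (m : 'X_{1..N}) : mnm_seq N m = m.
Proof. by apply/mnmP => i; rewrite mnmE mnm_tnth (tnth_nth 0%N). Qed.

Lemma mnm_seqE N u : size u = N -> mnm_seq N u = u :> seq nat.
Proof.
move=> uN; apply: (@eq_from_nth _ 0%N) => [|i]; rewrite size_tuple // => iN.
by rewrite -(mnm_nth _ _ (Ordinal iN)) mnmE.
Qed.

Lemma mdeg_sumn N (m : 'X_{1..N}) : mdeg m = sumn m.
Proof. by rewrite sumnE. Qed.

Lemma lem_all2 N (w u : 'X_{1..N}) : (w <= u)%MM = all2 leq w u.
Proof.
rewrite all2E !size_tuple eqxx /=.
apply/mnm_lepP/(all_nthP (0, 0)%N) => /= h i.
  rewrite size_zip !size_tuple minnn => iN.
  by rewrite nth_zip ?size_tuple //= -!(mnm_nth _ _ (Ordinal iN)).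
have := h i; rewrite size_zip !size_tuple minnn ltn_ord => /(_ isT).
by rewrite nth_zip ?size_tuple //= !(mnm_nth 0%N).
Qed.

Lemma is_pure_O_sequence_stack (b s : seq nat) (e : nat) :
  all (ltn 0) b -> all (ltn 0) s -> (e < size s)%N ->
  is_pure_O_sequence (\sum_(u <- stack b e.+1 s) 'X^(sumn u) : {poly int}).
Proof.
move=> b_gt0 s_gt0 es; pose N := (e.+1 + size b)%N.
pose M : {fset 'X_{1..N}} := [fset mnm_seq N u | u in stack b e.+1 s]%fset.
have memM (m : 'X_{1..N}) : (m \in M) = in_stack b e.+1 s m.
  apply/imfsetP/idP => [[u /= + ->]|mS].
    by rewrite mem_stack => uS; rewrite mnm_seqE // (size_in_stack uS).
  by exists (m : seq nat); rewrite /= ?mem_stack ?mnm_seqK.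
have permM : perm_eq [seq mnm_seq N u | u <- stack b e.+1 s] M.
  apply: uniq_perm; [|exact: fset_uniq|].
    rewrite map_inj_in_uniq ?uniq_stack // => u v; rewrite !mem_stack => uS vS uv.
    rewrite -(mnm_seqE (size_in_stack uS)).
    by rewrite -[in RHS](mnm_seqE (size_in_stack vS)) uv.
  move=> m; rewrite memM; apply/mapP/idP => [[u + ->]|mS].
    by rewrite mem_stack => uS; rewrite mnm_seqE // (size_in_stack uS).
  by exists (m : seq nat); rewrite /= ?mem_stack ?mnm_seqK.
(* This is n - d when [b] and [s] are the sizes of the forced and the free blocks. *)
pose top := (sumn s + sumn b - size b - e.+1)%N.
have topM m : m \in M -> exists2 m', m' \in M & (m <= m')%MM /\ mdeg m' = top.
  rewrite memM => /(in_stack_top s_gt0)[v mv [vS sv]].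
  have vE := mnm_seqE (size_in_stack vS).
  exists (mnm_seq N v); rewrite ?memM ?lem_all2 ?vE //; split=> //.
  by rewrite mdeg_sumn vE /top; lia.
have le_top m : m \in M -> (mdeg m <= top)%N.
  case/topM => m' _ [/mnm_lepP mm' <-]; rewrite !mdegE.
  by apply: leq_sum => i _.
have [m0 m0M m0top] : exists2 m0, m0 \in M & mdeg m0 = top.
  have := stack_neq0 b_gt0 s_gt0 es; set u := nseq _ _ => uS.
  have [|m mM [_ mtop]] := topM (mnm_seq N u); last by exists m.
  by rewrite memM mnm_seqE // size_nseq.
have maxM : (\max_(m <- M) (mdeg m).+1)%N = top.+1.
  apply/eqP; rewrite eqn_leq; apply/andP; split.
    by apply/bigmax_leqP_seq => m mM _; rewrite ltnS le_top.
  by rewrite -m0top; exact: (bigmaxn_sup_seq m0 m0M).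
exists N, M; split.
- move=> u w; rewrite !memM => uS; rewrite lem_all2 => wu.
  exact: in_stack_down uS.
- have maxdeg u : is_max_monomial M u -> mdeg u = top.
    by move=> [uM umax]; have [m' m'M [/umax<- //]] := topM u uM.
  by move=> u w /maxdeg -> /maxdeg ->.
(* The degree vector is the coefficient list of a polynomial because its last entry, the number of
   monomials of degree [top], is not 0. *)
rewrite -[RHS](@PolyK _ 0).
  congr polyseq; apply/polyP => i; rewrite coef_Poly coef_sum.
  transitivity ((count (fun m => mdeg m == i) M)%:Z).
    rewrite -(permP permM) count_map -sum1_count -natz natr_sum [RHS]big_mkcond.
    rewrite big_seq [RHS]big_seq; apply: eq_bigr => u; rewrite mem_stack => uS.
    rewrite coefXn /= mdeg_sumn (mnm_seqE (size_in_stack uS)) eq_sym.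
    by case: eqP.
  rewrite /degree_vector maxM; case: (ltnP i top.+1) => it.
    by rewrite (nth_map 0%N) ?size_mkseq // nth_mkseq.
  rewrite nth_default; last by rewrite size_map size_mkseq.
  apply/eqP; rewrite -[_ == _]/(count _ M == 0)%N -leqn0 leqNgt -has_count.
  apply/hasPn => m /le_top mt /=.
  by rewrite ltn_eqF // (leq_ltn_trans mt).
rewrite /degree_vector maxM -nth_last size_map size_mkseq [top.+1.-1]/=.
rewrite (nth_map 0%N) ?size_mkseq // nth_mkseq // eqz_nat -lt0n -has_count.
by apply/hasP; exists m0 => //; rewrite m0top.
Qed.

(** * The h-polynomial of the cover ideal as the degree count of the order ideal *)

Theorem theorem3p7 (k : fieldType) (d p t : nat) (hd : (1 <= d)%N)
    (hp : (d <= p)%N) (ht : (t + 2 <= d)%N)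
    (a : 'I_p -> nat) (ha : forall i, (0 < a i)%N)
    (n : nat) (hn : n = (\sum_(i < p) a i)%N)
    (A : 'I_p -> {set 'I_n}) (hA : is_block_partition a A) :
  exists h : {poly int},
    is_h_poly (cover_ideal (k := k) (Delta d t A)) h /\
    is_pure_O_sequence h.
Proof.
have [cA dA _] := hA.
have td : (t <= d)%N by lia.
have tp : (t <= p)%N by lia.
have A_gt0 i : (0 < #|A i|)%N by rewrite cA.
pose b := [seq #|A i| | i : 'I_p <- enum 'I_p & (i < t)%N].
pose s := [seq #|A i| | i <- free_blocks p t].
have sum_count (P : pred 'I_p) : size [seq i <- enum 'I_p | P i] = #|P|.
  by rewrite size_filter -sum1_count big_enum_cond sum1_card.
have size_b : size b = t.
  rewrite size_map sum_count -sum1_card (big_ord_narrow tp) sum1_card.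
  exact: card_ord.
have size_s : size s = (p - t)%N.
  have := cardC (fun i : 'I_p => (i < t)%N); rewrite card_ord => <-.
  rewrite -sum_count -(size_map (fun i => #|A i|)) -/b size_b addKn.
  by rewrite size_map sum_count; apply: eq_card => i; rewrite !inE -leqNgt.
have gt0 l : all (ltn 0) [seq #|A i| | i <- l].
  by apply/allP => _ /mapP[i _ ->]; exact: A_gt0.
have facetE F : (F \in facets (Delta d t A)) = is_Delta_generator d t A F.
  exact: facets_Delta.
have card_facet F : F \in facets (Delta d t A) -> #|F| = d.
  by rewrite facetE; apply: card_generator.
have facet_ex : exists F, F \in facets (Delta d t A).
  (* The monomial 1 makes no block full, so it lies outside the cover ideal and thereby exhibits a
     facet. *)
  have : avoids (Delta d t A) (mnm_ffun [ffun=> ord0 : 'I_1]).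
    have nf i : ~~ full A [ffun=> ord0 : 'I_1] i.
      have /card_gt0P[v vA] := A_gt0 i.
      by apply/forall_inPn; exists v; rewrite // ffunE.
    rewrite avoids_Delta //; apply/andP; split; first by apply/forall_inP.
    rewrite /nonfull_ge (eq_count (a2 := predT)) ?count_predT; last exact: nf.
    by move: size_s; rewrite size_map => ->; lia.
  by case/exists_inP => F; exists F.
have dn : (d <= n)%N.
  by case: facet_ex => F /card_facet <-; rewrite -[n in leqRHS]card_ord max_card.
have [e de] : exists e, (d - t)%N = e.+1 by exists (d - t).-1; lia.
exists (\sum_(u <- stack b e.+1 s) 'X^(sumn u)); split; last first.
  by apply: is_pure_O_sequence_stack; rewrite ?gt0 // size_s; lia.
exists (n - d)%N, (hilb (Delta d t A)); split.
- exact: krull_dim_cover_ideal.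
- by move=> j; exact: is_quot_dim_hilb.
(* Multiplying by (1 - X)^d raises the exponent n - d to n, where [gf_Delta] applies; on the other
   side d is the number of variables of the order ideal, as [stack_numer] requires. *)
apply: is_hilbert_series_hilb => K; apply: (@eqX_lcancel K d).
rewrite mulrA -exprD subnKC //; apply: eqX_trans; first exact: gf_Delta.
have -> : d = (e.+1 + size b)%N by rewrite size_b; lia.
rewrite stack_numer size_b -de => i _; congr (polyseq (_ * _))`_i; last first.
  by rewrite addnK.
by rewrite big_map big_filter big_enum_cond.
Qed.
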